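(* Let $\mathcal P_3^+$ be the class of probability measures on $\mathbb{R}^d$ with finite third moments and positive definite covariance. For $P\in\mathcal P_3^+$, write $m_P$ and $S_P$ for its mean and covariance. Suppose a family of maps $(T_t)_{t\ge0}$ on $\mathcal P_3^+$ has the form $$T_tP=\mathcal{L}\{m_P+a(t)(X-m_P)+b(t)Z_P\},$$ where $X\sim P$, $Z_P\sim\mathcal{N}(0,S_P)$ is independent of $X$, and $a,b:[0,\infty)\to\mathbb{R}$ are continuous functions (not depending on $P$) with $a(0)=1$, $b(0)=0$, $b(t)\ge0$, and $0\le a(t)\le1$ for all $t\ge 0$. Assume that: 1. $T_t$ preserves mean and covariance for every $P\in\mathcal P_3^+$ (and every $t\ge0$); 2. $(T_t)_{t\ge0}$ is a semigroup on $\mathcal P_3^+$, that is, $T_{s+t}P=T_s(T_tP)$ for all $s,t\ge0$ and all $P\in\mathcal P_3^+$; 3. the family is not the identity, meaning $a(t)<1$ for at least one $t>0$. Then there is a constant $c>0$ such that for all $t\ge0$ $$a(t)=e^{-ct},\qquad b(t)=\sqrt{1-e^{-2ct}}.$$ Thus, after the time change $t\mapsto ct$ (measuring time in units of $ct$), the family is exactly the Ornstein--Uhlenbeck Gaussianization path $$T_tP=\mathcal{L}\{m_P+e^{-t}(X-m_P)+\sqrt{1-e^{-2t}}\,Z_P\}.$$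
   Context: $\mathcal{L}\{Y\}$ denotes the law (distribution) of a random vector $Y$. $\mathcal{N}(\mu,\Sigma)$ denotes the Gaussian distribution on $\mathbb{R}^d$ with mean $\mu$ and covariance $\Sigma$. *)

(* Defs.v *)
From HB Require Import structures.
From mathcomp Require Import all_boot all_order all_algebra.
From mathcomp Require Import all_classical all_reals all_analysis.

Set Implicit Arguments.
Unset Strict Implicit.
Unset Printing Implicit Defensive.

Import Order.TTheory GRing.Theory Num.Theory.
Import numFieldNormedType.Exports.

Local Open Scope classical_set_scope.
Local Open Scope ring_scope.

Definition measure_cV_display : measure_display.
Proof. exact: default_measure_display. Qed.

(* R^d is 'cV[R]_d. Its Borel sigma-algebra is given as the product one, i.e.
   the one generated by the coordinates, as the library does for tuples. *)
Section measurable_cV.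
Context {R : realType} (n : nat).

Let coors : 'I_n -> 'cV[R]_n -> R := fun i x => x i 0.

Let cV_set0 : g_sigma_preimage coors set0.
Proof. exact: sigma_algebra0. Qed.

Let cV_setC A : g_sigma_preimage coors A -> g_sigma_preimage coors (~` A).
Proof. exact: sigma_algebraC. Qed.

Let cV_bigcup (F : (set 'cV[R]_n)^nat) :
  (forall i, g_sigma_preimage coors (F i)) ->
  g_sigma_preimage coors (\bigcup_i (F i)).
Proof. exact: sigma_algebra_bigcup. Qed.

HB.instance Definition _ := @isMeasurable.Build measure_cV_display
  'cV[R]_n (g_sigma_preimage coors) cV_set0 cV_setC cV_bigcup.

End measurable_cV.

(* Library measures are functions on all subsets and carry no information on
   non-measurable ones: laws are compared on measurable sets only. *)
Definition same_law d (T : measurableType d) (R : realType)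
    (mu nu : set T -> \bar R) : Prop :=
  forall A, measurable A -> mu A = nu A.

Definition independent_RV d d1 d2 (O : measurableType d)
    (T1 : measurableType d1) (T2 : measurableType d2) (R : realType)
    (Pr : probability O R) (X : O -> T1) (Y : O -> T2) : Prop :=
  forall A B, measurable A -> measurable B ->
    Pr (X @^-1` A `&` Y @^-1` B) = (Pr (X @^-1` A) * Pr (Y @^-1` B))%E.

Section laws.
Context {R : realType} {d : nat}.
Implicit Types P Q : probability 'cV[R]_d R.

Definition enorm (x : 'cV[R]_d) : R := Num.sqrt (\sum_i x i 0 ^+ 2).

Definition mean P : 'cV[R]_d := \col_i fine 'E_P[fun x => x i 0].

Definition cov P : 'M[R]_d :=
  \matrix_(i, j) fine (covariance P (fun x => x i 0) (fun x => x j 0)).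

Definition posdef (S : 'M[R]_d) : Prop :=
  S^T = S /\ forall u : 'cV[R]_d, u != 0 -> 0 < (u^T *m S *m u) 0 0.

Definition P3plus P : Prop :=
  (\int[P]_x ((enorm x) ^+ 3)%:E < +oo)%E /\ posdef (cov P).

(* s is the standard deviation. The degenerate case is treated apart because
   normal_prob m 0 is the uniform law on [0, 1] in the library. *)
Definition gaussian1 (mu : set R -> \bar R) : Prop :=
  exists m s : R, 0 <= s /\
    same_law mu (if s == 0 then \d_m : set R -> \bar R else normal_prob m s).

(* Q is N(m, S): all linear functionals are Gaussian on the line, and Q has
   mean m and covariance S. *)
Definition gaussian (m : 'cV[R]_d) (S : 'M[R]_d) Q : Prop :=
  [/\ forall u : 'cV[R]_d,
        gaussian1 (pushforward Q (fun z : 'cV[R]_d => (u^T *m z) 0 0 : R)),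
      mean Q = m & cov Q = S].

(* Q is the law of m_P + al (X - m_P) + be Z, where X ~ P and Z ~ N(0, S_P) is
   independent of X. *)
Definition gaussianization (al be : R) P Q : Prop :=
  exists (dO : measure_display) (O : measurableType dO)
    (Pr : probability O R) (X Z : {RV Pr >-> 'cV[R]_d}),
    [/\ same_law (distribution Pr X) P,
        gaussian 0 (cov P) (distribution Pr Z),
        independent_RV Pr X Z &
        same_law Q (pushforward Pr
          (fun w => mean P + al *: (X w - mean P) + be *: Z w))].

End laws.

(* Main.v *)
Require Import Defs.
From HB Require Import structures.
From mathcomp Require Import all_boot all_order all_algebra.
From mathcomp Require Import all_classical all_reals all_analysis.
From mathcomp Require Import measurable_realfun.
From mathcomp Require Import ring lra.

(* The Gaussian noise is centered, independent of X and has vanishing third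
   moment. Comparing second central moments of one coordinate therefore gives
   a(t)^2 + b(t)^2 = 1, while the third central moment is multiplied by a(t)^3.
   On a law with nonzero third central moment the semigroup property becomes
   a(s + t) = a(s) a(t), so that a is an exponential by continuity.
   Existence of the third moment of the noise is not computed from the Gaussian
   density: b Z is a difference of variables with finite third moments. *)

Import Order.TTheory GRing.Theory Num.Theory.
Import numFieldNormedType.Exports.

Local Open Scope classical_set_scope.
Local Open Scope ring_scope.

Set Implicit Arguments.
Unset Strict Implicit.
Unset Printing Implicit Defensive.

(** * Transfer of integrals between variables with the same law *)

Section equal_laws.
Context {d1 d2 d : measure_display} {T1 : measurableType d1}
  {T2 : measurableType d2} {Y : measurableType d} {R : realType}.
Variables (m1 : {measure set T1 -> \bar R}) (m2 : {measure set T2 -> \bar R}).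
Variables (U : T1 -> Y) (V : T2 -> Y).
Hypotheses (mU : measurable_fun setT U) (mV : measurable_fun setT V).
Hypothesis UV : forall A, measurable A -> m1 (U @^-1` A) = m2 (V @^-1` A).

Let U_mixin := isMeasurableFun.Build _ _ _ _ _ mU.
Let U_pack : {mfun _ >-> _} := HB.pack U U_mixin.
Let V_mixin := isMeasurableFun.Build _ _ _ _ _ mV.
Let V_pack : {mfun _ >-> _} := HB.pack V V_mixin.

(** Both sides are integrals of [f] against image measures that agree on measurable sets. The
    variables may live on different spaces, so moments can be carried from a law to any variable
    representing it. *)
Lemma eq_law_ge0_integral (f : Y -> \bar R) : measurable_fun setT f ->
  (forall y, 0 <= f y)%E -> (\int[m1]_x f (U x) = \int[m2]_x f (V x))%E.
Proof.
move=> mf f0.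
have e1 := @ge0_integral_pushforward _ _ _ _ R _ mU m1 setT f measurableT mf
  (fun y _ => f0 y).
have e2 := @ge0_integral_pushforward _ _ _ _ R _ mV m2 setT f measurableT mf
  (fun y _ => f0 y).
rewrite preimage_setT in e1; rewrite preimage_setT in e2.
rewrite -[LHS]e1 -[RHS]e2.
by apply: (@eq_measure_integral _ _ _ _ (pushforward m2 V_pack)
  (pushforward m1 U_pack)) => A mA _; exact: UV.
Qed.

Lemma eq_law_integrable (f : Y -> \bar R) : measurable_fun setT f ->
  m1.-integrable setT (f \o U) -> m2.-integrable setT (f \o V).
Proof.
move=> mf /integrableP[_ fU]; apply/integrableP; split.
  exact: measurableT_comp.
rewrite -(@eq_law_ge0_integral (fun y => `|f y|)%E) //.
exact: measurableT_comp.
Qed.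

Lemma eq_law_integral (f : Y -> \bar R) : measurable_fun setT f ->
  m1.-integrable setT (f \o U) -> (\int[m1]_x f (U x) = \int[m2]_x f (V x))%E.
Proof.
move=> mf ifU.
have -> : (\int[m1]_x f (U x) = \int[m1]_x f^\+ (U x) - \int[m1]_x f^\- (U x))%E.
  transitivity (\int[m1]_x (f \o U) x)%E => //; rewrite integralE.
  by congr (_ - _)%E; apply: eq_integral => x _;
    rewrite (funepos_comp, funeneg_comp).
have -> : (\int[m2]_x f (V x) = \int[m2]_x f^\+ (V x) - \int[m2]_x f^\- (V x))%E.
  transitivity (\int[m2]_x (f \o V) x)%E => //; rewrite integralE.
  by congr (_ - _)%E; apply: eq_integral => x _;
    rewrite (funepos_comp, funeneg_comp).
have e (g : Y -> \bar R) : measurable_fun setT g ->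
    (\int[m1]_x g^\+ (U x) = \int[m2]_x g^\+ (V x))%E.
  move=> mg; apply: (@eq_law_ge0_integral (g^\+)%E) => //.
  exact: measurable_funepos.
have e' (g : Y -> \bar R) : measurable_fun setT g ->
    (\int[m1]_x g^\- (U x) = \int[m2]_x g^\- (V x))%E.
  move=> mg; apply: (@eq_law_ge0_integral (g^\-)%E) => //.
  exact: measurable_funeneg.
by congr (_ - _)%E; [exact: e | exact: e'].
Qed.

End equal_laws.

(** * Expectation of a product of independent variables *)

Section independence.
Context {d : measure_display} {O : measurableType d} {R : realType}.
Variables (Pr : probability O R) (U V : O -> R).
Hypotheses (mU : measurable_fun setT U) (mV : measurable_fun setT V).
Hypothesis indep : independent_RV Pr U V.

Let U_mixin := isMeasurableFun.Build _ _ _ _ _ mU.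
Let U_pack : {mfun _ >-> _} := HB.pack U U_mixin.
Let V_mixin := isMeasurableFun.Build _ _ _ _ _ mV.
Let V_pack : {mfun _ >-> _} := HB.pack V V_mixin.

Let mUV : measurable_fun setT (fun w => (U w, V w)).
Proof. exact: measurable_fun_pair. Qed.
Let UV_mixin := isMeasurableFun.Build _ _ _ _ _ mUV.
Let UV_pack : {mfun _ >-> _} := HB.pack (fun w => (U w, V w)) UV_mixin.

Let PU : probability _ R := distribution Pr U_pack.
Let PV : probability _ R := distribution Pr V_pack.

(** Independence is the equality on rectangles, and these determine the product measure. *)
Let joint_law (A : set (R * R)) : measurable A ->
  Pr ((fun w => (U w, V w)) @^-1` A) = (PU \x PV)%E A.
Proof.
move=> mA; symmetry.
exact: (@product_measure_unique _ _ _ _ R PU PV (pushforward Pr UV_pack)).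
Qed.

Let mprod : measurable_fun setT (fun z : R * R => (z.1 * z.2)%:E).
Proof.
by apply/measurable_EFinP; apply: measurable_funM.
Qed.

Let law_integrable (W : {mfun O >-> R}) : Pr.-integrable setT (EFin \o W) ->
  (distribution Pr W : probability _ R).-integrable setT EFin.
Proof.
exact: (@eq_law_integrable _ _ _ _ _ _ R Pr (distribution Pr W : probability _ R)
  W id).
Qed.

Let law_integral (W : {mfun O >-> R}) : Pr.-integrable setT (EFin \o W) ->
  (\int[Pr]_w (W w)%:E = \int[(distribution Pr W : probability _ R)]_x x%:E)%E.
Proof.
exact: (@eq_law_integral _ _ _ _ _ _ R Pr (distribution Pr W : probability _ R)
  W id _ _ _ EFin).
Qed.

(** By Tonelli the integral of [|x y|] factors into two finite absolute first moments. *)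
Let prod_integrable : Pr.-integrable setT (EFin \o U) ->
  Pr.-integrable setT (EFin \o V) ->
  (PU \x PV)%E.-integrable setT (fun z : R * R => (z.1 * z.2)%:E).
Proof.
move=> /(law_integrable (W := U_pack)) /integrable_norm iU.
move=> /(law_integrable (W := V_pack)) /integrable_norm iV.
apply/integrable12ltyP => //=.
have fV := integrable_fin_num measurableT iV.
under eq_integral => x _.
  under eq_integral do rewrite /= normrM EFinM.
  rewrite integralZl//.
  over.
rewrite -(fineK fV) integralZr //; apply: lte_mul_pinfty => //.
  by apply: integral_ge0 => x _; rewrite lee_fin.
- exact: integrable_fin_num.
- by rewrite ltry.
Qed.

Lemma indep_integrableM : Pr.-integrable setT (EFin \o U) ->
  Pr.-integrable setT (EFin \o V) ->
  Pr.-integrable setT (fun w => (U w * V w)%:E).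
Proof.
move=> iU iV.
apply: (@eq_law_integrable _ _ _ _ _ _ R (PU \x PV)%E Pr id
  (fun w => (U w, V w)) _ _ _ (fun z => (z.1 * z.2)%:E)) => //.
- by move=> A mA; exact: (esym (joint_law mA)).
- exact: prod_integrable.
Qed.

(** Fubini for the product law, to which the joint law of [(U, V)] is equal. *)
Lemma indep_RintegralM : Pr.-integrable setT (EFin \o U) ->
  Pr.-integrable setT (EFin \o V) ->
  \int[Pr]_w (U w * V w) = (\int[Pr]_w U w) * \int[Pr]_w V w.
Proof.
move=> iU iV; rewrite /Rintegral.
have -> : (\int[Pr]_w (U w * V w)%:E = \int[PU \x PV]_z (z.1 * z.2)%:E)%E.
  symmetry; apply: (@eq_law_integral _ _ _ _ _ _ R (PU \x PV)%E Pr id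
    (fun w => (U w, V w)) _ _ _ (fun z => (z.1 * z.2)%:E)) => //.
  - by move=> A mA; exact: (esym (joint_law mA)).
  - exact: prod_integrable.
rewrite -(integral12_prod_meas1 (prod_integrable iU iV)) /fubini_F /=.
have iV' := law_integrable (W := V_pack) iV; have iU' := law_integrable (W := U_pack) iU.
have fV := integrable_fin_num measurableT iV'.
rewrite (law_integral (W := U_pack))// (law_integral (W := V_pack))//.
under eq_integral => x _.
  under eq_integral do rewrite EFinM.
  rewrite integralZl//.
  over.
rewrite -(fineK fV) integralZr // fineM //.
exact: (integrable_fin_num measurableT iU').
Qed.

End independence.

(** * Symmetry of one-dimensional Gaussian laws and their odd moments *)

Section gaussian_symmetry.
Context {R : realType}.
Local Notation mu := (@lebesgue_measure R).

Let measurable_reflection (c : R) :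
  measurable_fun [set: R] (fun x : R => c - x).
Proof. by apply: measurable_funB. Qed.

Lemma lebesgue_measure_reflection (c : R) (A : set R) : measurable A ->
  mu ((fun x => c - x) @^-1` A) = mu A.
Proof.
move=> mA.
pose r : measurableTypeR R -> measurableTypeR R := fun x => c - x.
have mr : measurable_fun setT r by exact: measurable_reflection.
suff -> : mu A = pushforward mu r A by [].
apply: lebesgue_measure_unique => //= _ [[u v]] _ <-; rewrite /pushforward.
(* The reflection exchanges the open and the closed end, which leaves the length unchanged; lengths
   of such intervals determine Lebesgue measure. *)
have -> : r @^-1` `]u, v]%classic = `[c - v, c - u[%classic.
  by apply/seteqP; split => x; rewrite /r /= !in_itv /= => /andP[? ?];
    apply/andP; split; lra.
rewrite !lebesgue_measure_itv /= !lte_fin ltrD2l ltrN2.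
by case: ifP => // _; rewrite -!EFinB; congr EFin; lra.
Qed.

Lemma normal_pdf_reflection (m s x : R) : s != 0 ->
  normal_pdf m s (2 * m - x) = normal_pdf m s x.
Proof.
move=> s0.
have E y : normal_pdf m s y = normal_peak s * normal_fun m s y.
  by rewrite normal_pdfE.
rewrite !E /normal_fun.
by rewrite (_ : 2 * m - x - m = - (x - m)) ?sqrrN//; ring.
Qed.

Lemma normal_prob_reflection (m s : R) (A : set R) : s != 0 -> measurable A ->
  normal_prob m s ((fun x => 2 * m - x) @^-1` A) = normal_prob m s A.
Proof.
move=> s0 mA.
pose r : measurableTypeR R -> measurableTypeR R := fun x => 2 * m - x.
have mr : measurable_fun setT r by exact: measurable_reflection.
have mpdf : measurable_fun A (fun x => (normal_pdf m s x)%:E).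
  by apply/measurable_EFinP; apply: measurable_funTS; exact: measurable_normal_pdf.
rewrite /normal_prob.
(* The symmetry of the density makes the integrand a function of [r x], so that the change of
   variables by [r] applies. *)
transitivity (\int[mu]_(x in r @^-1` A) (normal_pdf m s (r x))%:E)%E.
  by apply: eq_integral => x _; rewrite normal_pdf_reflection.
rewrite -(ge0_integral_pushforward mr mu mA mpdf).
  apply: eq_measure_integral => B mB _ /=.
  exact: lebesgue_measure_reflection.
by move=> y _; rewrite lee_fin normal_pdf_ge0.
Qed.

(** The degenerate case is symmetric too: the reflection about [m] fixes the atom [m]. *)
Lemma gaussian1_reflection (nu : set R -> \bar R) : gaussian1 nu ->
  exists m : R, forall A, measurable A ->
    nu A = nu ((fun x => 2 * m - x) @^-1` A).
Proof.
move=> [m [s [_ nuE]]]; exists m => A mA.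
have mrA : measurable ((fun x => 2 * m - x) @^-1` A).
  by rewrite -[X in measurable X]setTI; exact: measurable_reflection.
rewrite !nuE //; case: eqVneq => [_|s0]; last by rewrite normal_prob_reflection.
rewrite /dirac !indicE; congr ((nat_of_bool _)%:R%:E).
by apply/idP/idP => /set_mem h; apply/mem_set; rewrite /preimage/= in h *;
  move: h; have -> : 2 * m - m = m by ring.
Qed.

(** The center of symmetry must be the mean, which is 0. Hence [V] and [- V] have the same law, and
    the third moment equals its opposite. *)
Lemma gaussian1_odd_moment d (O : measurableType d) (Pr : probability O R)
    (V : O -> R) : measurable_fun setT V ->
  gaussian1 (pushforward Pr V) ->
  Pr.-integrable setT (EFin \o V) ->
  Pr.-integrable setT (fun w => (V w ^+ 3)%:E) ->
  \int[Pr]_w V w = 0 -> \int[Pr]_w V w ^+ 3 = 0.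
Proof.
move=> mV /gaussian1_reflection[m symV] iV iV3 EV.
have mW : measurable_fun setT (fun w => 2 * m - V w) by exact: measurable_funB.
have e (f : R -> R) : measurable_fun setT f ->
    Pr.-integrable setT (fun w => (f (V w))%:E) ->
    \int[Pr]_w f (V w) = \int[Pr]_w f (2 * m - V w).
  move=> mf ifV; congr fine.
  apply: (@eq_law_integral _ _ _ _ _ _ R Pr Pr V (fun w => 2 * m - V w) mV mW
    symV (EFin \o f)) => //.
  exact/measurable_EFinP.
(* Reflecting the first moment gives [0 = 2 * m - 0]. *)
have m0 : m = 0.
  have := e id (@measurable_id _ _ _) iV; rewrite EV RintegralB //=.
    rewrite EV Rintegral_cst //= probability_setT /= => h; lra.
  exact: finite_measure_integrable_cst.
have := e (fun x => x ^+ 3) (@exprn_measurable R setT 3) iV3.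
rewrite m0 mulr0.
under [X in _ = X -> _]eq_Rintegral do
  rewrite sub0r exprNn -signr_odd /= expr1.
rewrite RintegralZl // => h; lra.
Qed.

End gaussian_symmetry.

(** * Variables with a finite third absolute moment *)

Section cube_integrability.
Context {d : measure_display} {O : measurableType d} {R : realType}.
Variable Pr : probability O R.
Implicit Types f g : O -> R.

(** This is membership in L^3, since integrability of [f ^+ 3] is that of its absolute value. *)
Definition cube_integrable f :=
  measurable_fun setT f /\ Pr.-integrable setT (fun x => (f x ^+ 3)%:E).

Lemma cube_integrable_dom f (g : O -> R) : measurable_fun setT f ->
  Pr.-integrable setT (EFin \o g) -> (forall x, `|f x| ^+ 3 <= g x) ->
  cube_integrable f.
Proof.
move=> mf ig fg; split=> //; apply: (le_integrable measurableT _ _ ig).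
  by apply/measurable_EFinP; exact: measurable_funX.
move=> x _; rewrite /= lee_fin normrX.
exact: le_trans (fg x) (ler_norm _).
Qed.

Let integrable_cube_norm f : cube_integrable f ->
  Pr.-integrable setT (EFin \o (fun x => `|f x ^+ 3|)).
Proof. by move=> [_ /integrable_norm]. Qed.

Lemma cube_integrableD f g : cube_integrable f -> cube_integrable g ->
  cube_integrable (fun x => f x + g x).
Proof.
move=> cf cg; have [mf _] := cf; have [mg _] := cg.
apply: (@cube_integrable_dom _ (fun x => 4 * (`|f x ^+ 3| + `|g x ^+ 3|))).
- exact: measurable_funD.
- apply: eq_integrable (integrableZl measurableT 4
    (integrableD measurableT (integrable_cube_norm cf)
      (integrable_cube_norm cg))) => //.
move=> x; rewrite !normrX.
apply: (@le_trans _ _ ((`|f x| + `|g x|) ^+ 3)).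
  by rewrite ler_pXn2r ?nnegrE ?addr_ge0 // ler_normD.
move: (normr_ge0 (f x)) (normr_ge0 (g x)).
move: `|f x| `|g x| => u v u0 v0.
rewrite -subr_ge0.
(* This identity proves the convexity bound [(u + v) ^+ 3 <= 4 * (u ^+ 3 + v ^+ 3)] for nonnegative
   [u] and [v]. *)
rewrite (_ : _ - _ = 3 * ((u + v) * (u - v) ^+ 2)); last by ring.
apply: mulr_ge0; first exact: ler0n.
by apply: mulr_ge0; [exact: addr_ge0 | exact: sqr_ge0].
Qed.

Lemma cube_integrableZ k f : cube_integrable f ->
  cube_integrable (fun x => k * f x).
Proof.
move=> cf; have [mf _] := cf.
apply: (@cube_integrable_dom _ (fun x => `|k| ^+ 3 * `|f x ^+ 3|)).
- exact: measurable_funM.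
- apply: eq_integrable (integrableZl measurableT (`|k| ^+ 3)
    (integrable_cube_norm cf)) => //.
by move=> x; rewrite normrM exprMn !normrX.
Qed.

Lemma cube_integrable_cst k : cube_integrable (cst k).
Proof.
by split=> //; exact: (@finite_measure_integrable_cst _ _ _ Pr setT (k ^+ 3)).
Qed.

(** The power is dominated by [1 + |f| ^+ 3]: by the constant where [|f| <= 1], by the cube
    elsewhere. *)
Lemma cube_integrable_expn f n : (n <= 3)%N -> cube_integrable f ->
  Pr.-integrable setT (EFin \o (fun x => f x ^+ n)).
Proof.
move=> n3 cf; have [mf _] := cf.
have i1 : Pr.-integrable setT (EFin \o cst (1 : R)).
  exact: finite_measure_integrable_cst.
apply: (le_integrable measurableT _ _
  (integrableD measurableT i1 (integrable_cube_norm cf))) => //.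
  by apply/measurable_EFinP; exact: measurable_funX.
move=> x _; rewrite /= lee_fin [leRHS]ger0_norm ?addr_ge0 // !normrX.
have [x1|x1] := leP `|f x| 1.
  by rewrite ler_wpDr ?exprn_ge0 // exprn_ile1.
by rewrite ler_wpDl // ler_weXn2l // ltW.
Qed.

Lemma cube_integrable1 f : cube_integrable f ->
  Pr.-integrable setT (EFin \o f).
Proof. exact: (@cube_integrable_expn f 1). Qed.

End cube_integrability.

(** * Second and third moments of sums of independent centered variables *)

Lemma independent_RV_comp d d1 d2 d3 d4 (O : measurableType d)
    (T1 : measurableType d1) (T2 : measurableType d2)
    (T3 : measurableType d3) (T4 : measurableType d4) (R : realType)
    (Pr : probability O R) (X : O -> T1) (Y : O -> T2)
    (f : T1 -> T3) (g : T2 -> T4) :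
  measurable_fun setT f -> measurable_fun setT g ->
  independent_RV Pr X Y -> independent_RV Pr (f \o X) (g \o Y).
Proof.
move=> mf mg XY A B mA mB; apply: (XY (f @^-1` A) (g @^-1` B)).
  by rewrite -[X in measurable X]setTI; exact: mf.
by rewrite -[X in measurable X]setTI; exact: mg.
Qed.

Section centered_sum.
Context {d : measure_display} {O : measurableType d} {R : realType}.
Variables (Pr : probability O R) (U V : O -> R).
Hypotheses (cU : cube_integrable Pr U) (cV : cube_integrable Pr V).
Hypothesis UV : independent_RV Pr U V.
Hypotheses (EU : \int[Pr]_w U w = 0) (EV : \int[Pr]_w V w = 0).

Let iE f := Pr.-integrable setT (EFin \o f).

Let iED (f g : O -> R) : iE f -> iE g -> iE (fun x => f x + g x).
Proof. exact: integrableD. Qed.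

Let iEZ k (f : O -> R) : iE f -> iE (fun x => k * f x).
Proof. exact: integrableZl. Qed.

Let powers_indep j k :
  independent_RV Pr (fun w => U w ^+ j) (fun w => V w ^+ k).
Proof.
apply: (@independent_RV_comp _ _ _ _ _ _ _ _ _ _ _ _ _ _
  (fun x : R => x ^+ j) (fun x : R => x ^+ k)) UV; exact: exprn_measurable.
Qed.

Let iU j : (j <= 3)%N -> iE (fun w => U w ^+ j).
Proof. by move=> j3; exact: cube_integrable_expn. Qed.

Let iV j : (j <= 3)%N -> iE (fun w => V w ^+ j).
Proof. by move=> j3; exact: cube_integrable_expn. Qed.

Let mX (f : O -> R) j : measurable_fun setT f ->
  measurable_fun setT (fun w => f w ^+ j).
Proof. exact: measurable_funX. Qed.

Let iUV j k : (j <= 3)%N -> (k <= 3)%N -> iE (fun w => U w ^+ j * V w ^+ k).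
Proof.
move=> j3 k3; apply: indep_integrableM; [exact: mX cU.1|exact: mX cV.1| | |];
  [exact: powers_indep|exact: iU|exact: iV].
Qed.

Let EUV j k : (j <= 3)%N -> (k <= 3)%N -> \int[Pr]_w (U w ^+ j * V w ^+ k) =
  (\int[Pr]_w U w ^+ j) * \int[Pr]_w V w ^+ k.
Proof.
move=> j3 k3; apply: indep_RintegralM; [exact: mX cU.1|exact: mX cV.1| | |];
  [exact: powers_indep|exact: iU|exact: iV].
Qed.

Let EU1 : \int[Pr]_w (U w ^+ 1) = 0. Proof. exact: EU. Qed.

Let EV1 : \int[Pr]_w (V w ^+ 1) = 0. Proof. exact: EV. Qed.

Lemma centered_sum_moment2 al be :
  \int[Pr]_w (al * U w + be * V w) ^+ 2 =
  al ^+ 2 * (\int[Pr]_w U w ^+ 2) + be ^+ 2 * \int[Pr]_w V w ^+ 2.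
Proof.
(* The exponents 1 are kept so that [iUV] and [EUV] apply to the mixed term. *)
transitivity (\int[Pr]_w (al ^+ 2 * U w ^+ 2 +
  (2 * al * be * (U w ^+ 1 * V w ^+ 1) + be ^+ 2 * V w ^+ 2))).
  by apply: eq_Rintegral => w _; ring.
rewrite RintegralD //; last 2 first.
- exact/iEZ/iU.
- by apply: iED; [exact/iEZ/iUV|exact/iEZ/iV].
rewrite RintegralD //; last 2 first.
- exact/iEZ/iUV.
- exact/iEZ/iV.
rewrite !RintegralZl //; [|exact: iV|exact: iUV|exact: iU].
by rewrite EUV // EU1 mul0r mulr0 add0r.
Qed.

(** Each mixed term of the cube contains [U] or [V] to the first power, so its expectation has a
    vanishing factor. *)
Lemma centered_sum_moment3 al be :
  \int[Pr]_w (al * U w + be * V w) ^+ 3 =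
  al ^+ 3 * (\int[Pr]_w U w ^+ 3) + be ^+ 3 * \int[Pr]_w V w ^+ 3.
Proof.
transitivity (\int[Pr]_w (al ^+ 3 * U w ^+ 3 +
  (3 * al ^+ 2 * be * (U w ^+ 2 * V w ^+ 1) +
  (3 * al * be ^+ 2 * (U w ^+ 1 * V w ^+ 2) + be ^+ 3 * V w ^+ 3)))).
  by apply: eq_Rintegral => w _; ring.
rewrite RintegralD //; last 2 first.
- exact/iEZ/iU.
- by do 2 (apply: iED; first exact/iEZ/iUV); exact/iEZ/iV.
rewrite RintegralD //; last 2 first.
- exact/iEZ/iUV.
- by apply: iED; [exact/iEZ/iUV|exact/iEZ/iV].
rewrite RintegralD //; last 2 first.
- exact/iEZ/iUV.
- exact/iEZ/iV.
rewrite !RintegralZl //; [|exact: iV|exact: iUV|exact: iUV|exact: iU].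
by rewrite !EUV // EU1 EV1 mul0r !mulr0 !add0r.
Qed.

End centered_sum.

(** * Coordinates of random vectors and their central moments *)

Section coordinates.
Context {R : realType} {n : nat}.

Lemma measurable_coord (i : 'I_n) :
  measurable_fun setT (fun x : 'cV[R]_n => x i 0).
Proof.
move=> _ A mA; apply: sub_sigma_algebra.
(* The generating family is the union over all coordinates; the preimages under the [i]-th one are
   split off. *)
by rewrite (bigD1 i) //=; left; exists A.
Qed.

Lemma measurable_enorm : measurable_fun setT (@enorm R n).
Proof.
apply: (@measurableT_comp _ _ _ _ _ _ (@Num.sqrt R)).
  by apply: continuous_measurable_fun; exact: sqrt_continuous.
by apply: measurable_sum => i; apply: measurable_funX; exact: measurable_coord.
Qed.

Lemma normr_coord_le_enorm (x : 'cV[R]_n) i : `|x i 0| <= enorm x.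
Proof.
rewrite -sqrtr_sqr ler_wsqrtr // (bigD1 i) //= lerDl.
by apply: sumr_ge0 => j _; exact: sqr_ge0.
Qed.

Implicit Types P Q : probability 'cV[R]_n R.

Definition cmoment P i k : R := \int[P]_x (x i 0 - mean P i 0) ^+ k.

Lemma meanE P i : mean P i 0 = \int[P]_x x i 0.
Proof. by rewrite mxE expectation.unlock. Qed.

Lemma cov_cmoment P i : cov P i i = cmoment P i 2.
Proof.
rewrite mxE covariance.unlock expectation.unlock; congr fine.
apply: eq_integral => x _ /=; congr EFin; rewrite expr2.
by rewrite meanE.
Qed.

Lemma P3plus_cube_integrable P i : P3plus P ->
  cube_integrable P (fun x => x i 0).
Proof.
move=> [P3 _].
apply: (@cube_integrable_dom _ _ _ _ _ (fun x => enorm x ^+ 3)).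
- exact: measurable_coord.
- apply/integrableP; split.
    by apply/measurable_EFinP; apply: measurable_funX; exact: measurable_enorm.
  apply: le_lt_trans P3; rewrite le_eqVlt; apply/orP; left; apply/eqP.
  apply: eq_integral => x _ /=; congr EFin.
  by rewrite ger0_norm // exprn_ge0 // sqrtr_ge0.
by move=> x; rewrite ler_pXn2r ?nnegrE ?sqrtr_ge0 // normr_coord_le_enorm.
Qed.

End coordinates.

(** * Effect of one Gaussianization step on central moments *)

Section gaussianization_moments.
Context {R : realType} {n : nat}.
Implicit Types P Q : probability 'cV[R]_n R.

Let same_law_Rintegral P d (O : measurableType d) (Pr : probability O R)
    (Y : O -> 'cV[R]_n) i (f : R -> R) :
  same_law P (pushforward Pr Y) -> measurable_fun setT (fun w => Y w i 0) ->
  measurable_fun setT f -> P.-integrable setT (fun x => (f (x i 0))%:E) ->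
  \int[P]_x f (x i 0) = \int[Pr]_w f (Y w i 0).
Proof.
move=> PY mY mf iP; congr fine.
apply: (@eq_law_integral _ _ _ _ _ _ R P Pr (fun x => x i 0)
  (fun w => Y w i 0) _ _ _ (EFin \o f)) => //.
- exact: measurable_coord.
- move=> A mA; apply: PY; rewrite -[X in measurable X]setTI.
  exact: measurable_coord.
- exact/measurable_EFinP.
Qed.

Let same_law_cube P d (O : measurableType d) (Pr : probability O R)
    (Y : O -> 'cV[R]_n) i :
  same_law P (pushforward Pr Y) -> measurable_fun setT (fun w => Y w i 0) ->
  cube_integrable P (fun x => x i 0) ->
  cube_integrable Pr (fun w => Y w i 0).
Proof.
move=> PY mY [_ iP]; split=> //.
apply: (@eq_law_integrable _ _ _ _ _ _ R P Pr (fun x => x i 0)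
  (fun w => Y w i 0) _ _ _ (fun y => (y ^+ 3)%:E)) => //.
- exact: measurable_coord.
- move=> A mA; apply: PY; rewrite -[X in measurable X]setTI.
  exact: measurable_coord.
- by apply/measurable_EFinP; exact: exprn_measurable.
Qed.

Let measurable_centered c k : measurable_fun setT (fun x : R => (x - c) ^+ k).
Proof. by apply: measurable_funX; exact: measurable_funB. Qed.

Let integrable_centered P i k : (k <= 3)%N -> P3plus P ->
  P.-integrable setT (fun x : 'cV[R]_n => ((x i 0 - mean P i 0) ^+ k)%:E).
Proof.
move=> k3 hP; apply: (@cube_integrable_expn _ _ _ P
  (fun x => x i 0 - mean P i 0)) => //.
apply: cube_integrableD; first exact: P3plus_cube_integrable.
exact: cube_integrable_cst.
Qed.

Lemma cmoment1 P i : P3plus P -> cmoment P i 1 = 0.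
Proof.
move=> hP; have iP := cube_integrable1 (P3plus_cube_integrable i hP).
rewrite /cmoment; under eq_Rintegral do rewrite expr1.
rewrite RintegralB //; last exact: finite_measure_integrable_cst.
by rewrite -meanE Rintegral_cst //= probability_setT mulr1 subrr.
Qed.

(** Centered at the common mean, coordinate [i] of [Q] is represented by [al * U + be * V] with [U]
    and [V] independent and centered. The noise [V] has the variance of [U] and no third moment. *)
Lemma gaussianization_cmoment al be P Q i : P3plus P -> P3plus Q ->
  mean Q = mean P -> gaussianization al be P Q ->
  cmoment Q i 2 = (al ^+ 2 + be ^+ 2) * cmoment P i 2 /\
  cmoment Q i 3 = al ^+ 3 * cmoment P i 3.
Proof.
move=> hP hQ QP [dO [Om [Pr [X [Z [hX hZ XZ hQY]]]]]].
set Y := (fun w => _) in hQY.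
set c := mean P i 0.
pose U w := X w i 0 - c; pose V w := Z w i 0.
have YE w : Y w i 0 = c + (al * U w + be * V w).
  by rewrite /Y /U /c; move: (mean P) => m; rewrite !mxE addrA.
have mX : measurable_fun setT (fun w => X w i 0).
  by apply: (measurableT_comp (measurable_coord i)).
have mV : measurable_fun setT V.
  by apply: (measurableT_comp (measurable_coord i)).
have mU : measurable_fun setT U by exact: measurable_funB.
have mY : measurable_fun setT (fun w => Y w i 0).
  under eq_fun do rewrite YE.
  apply: measurable_funD => //.
  by apply: measurable_funD; apply: measurable_funM.
have hX' : same_law P (pushforward Pr X) by move=> A mA; rewrite -hX.
have cX := same_law_cube hX' mX (P3plus_cube_integrable i hP).
have cY := same_law_cube hQY mY (P3plus_cube_integrable i hQ).
have cU : cube_integrable Pr U.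
  by apply: cube_integrableD => //; exact: cube_integrable_cst.
have PU k : (k <= 3)%N -> \int[Pr]_w U w ^+ k = cmoment P i k.
  move=> k3; rewrite /cmoment.
  rewrite (same_law_Rintegral hX' mX (measurable_centered (mean P i 0) k)) //.
  exact: integrable_centered.
have QU k : (k <= 3)%N ->
    cmoment Q i k = \int[Pr]_w (al * U w + be * V w) ^+ k.
  move=> k3; rewrite /cmoment.
  rewrite (same_law_Rintegral hQY mY (measurable_centered (mean Q i 0) k)) //.
    apply: eq_Rintegral => w _; rewrite YE QP -/c; congr (_ ^+ _).
    by rewrite addrC addKr.
  exact: integrable_centered.
rewrite !QU // -!PU //.
(* For [be = 0] the noise drops out; otherwise one may divide by [be] to bound it. *)
have [-> | be0] := eqVneq be 0.
  under eq_Rintegral do rewrite mul0r addr0 exprMn.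
  under [X in _ /\ X = _]eq_Rintegral do rewrite mul0r addr0 exprMn.
  rewrite !RintegralZl ?(cube_integrable_expn _ cU) //.
  by rewrite expr0n addr0.
(* Here the finite third moment of [Q] is used: [V] is a linear combination of the output [Y], the
   input [U] and a constant. *)
have cV : cube_integrable Pr V.
  have -> : V = (fun w => be^-1 * (Y w i 0 + (- c + (- al) * U w))).
    by apply/funext => w; rewrite YE; field.
  apply: cube_integrableZ; apply: cube_integrableD => //.
  apply: cube_integrableD; first exact: cube_integrable_cst.
  exact: cube_integrableZ.
have EU : \int[Pr]_w U w = 0 by rewrite (PU 1) // cmoment1.
have [hZg mZ SZ] := hZ.
pose D : probability 'cV[R]_n R := distribution Pr Z.
have ZD : same_law D (pushforward Pr Z) by [].
have iD k : (k <= 3)%N -> D.-integrable setT (fun x => ((x i 0) ^+ k)%:E).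
  move=> k3; apply: (@eq_law_integrable _ _ _ _ _ _ R Pr D V
    (fun x => x i 0) mV (measurable_coord i) _ (fun y => (y ^+ k)%:E)) => //.
    by apply/measurable_EFinP; exact: exprn_measurable.
  exact: cube_integrable_expn k3 cV.
have EV : \int[Pr]_w V w = 0.
  rewrite -(same_law_Rintegral ZD mV (@measurable_id _ _ _) (iD 1 isT)).
  by rewrite -meanE mZ mxE.
(* The noise has covariance [cov P]; its diagonal entry is compared on both sides. *)
have EV2 : \int[Pr]_w V w ^+ 2 = cmoment P i 2.
  rewrite -cov_cmoment -SZ cov_cmoment /cmoment mZ mxE.
  rewrite (same_law_Rintegral ZD mV (measurable_centered 0 2)).
    by under [RHS]eq_Rintegral do rewrite subr0.
  by under eq_fun do rewrite subr0; exact: iD.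
have EV3 : \int[Pr]_w V w ^+ 3 = 0.
  apply: gaussian1_odd_moment => //; last 2 first.
  - exact: cube_integrable1.
  - exact: (cube_integrable_expn _ cV).
  (* The linear functional given by the [i]-th basis vector is the [i]-th coordinate. *)
  have := hZg (delta_mx i 0); congr gaussian1.
  apply/funext => A; rewrite /pushforward /distribution; congr (Pr _).
  rewrite /V /preimage /=; apply/funext => w /=.
  by rewrite trmx_delta -rowE mxE.
have UVi : independent_RV Pr U V.
  apply: (@independent_RV_comp _ _ _ _ _ _ _ _ _ _ _ _ _ _
    (fun x : 'cV[R]_n => x i 0 - c) (fun x : 'cV[R]_n => x i 0)) XZ.
    by apply: measurable_funB => //; exact: measurable_coord.
  exact: measurable_coord.
rewrite centered_sum_moment2 // centered_sum_moment3 // EV2 EV3 PU //.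
by rewrite mulr0 addr0 mulrDl.
Qed.

End gaussianization_moments.

(** * A finitely supported test law with nonzero third central moments *)

Section skewed_law.
Context {R : realType} (n : nat).

(** The index is a natural number because [msum] takes a sequence of measures; only the terms with
    [k < n] are summed. *)
Let e (k : nat) : 'cV[R]_n := \col_j (val j == k)%:R.

(* The uniform mixture over k of (\d_(2 e_k) + 2 \d_(- e_k)) / 3, which is
   centered with covariance a multiple of the identity. *)
Definition skewed_law : set 'cV[R]_n -> \bar R :=
  mscale ((3 * n%:R)^-1%:nng)
    (msum (fun k => measure_add (\d_(2 *: e k))
                      (measure_add (\d_(- e k)) (\d_(- e k)))) n).

HB.instance Definition _ := Measure.on skewed_law.

Let skewed_sum (g : 'cV[R]_n -> R) : R :=
  (3 * n%:R)^-1 * \sum_(k < n) (g (2 *: e k) + (g (- e k) + g (- e k))).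

Let ge0_integral_skewed (g : 'cV[R]_n -> R) : measurable_fun setT g ->
  (forall x, 0 <= g x) ->
  (\int[skewed_law]_x (g x)%:E = (skewed_sum g)%:E)%E.
Proof.
move=> mg g0; have mG : measurable_fun setT (EFin \o g) by exact/measurable_EFinP.
have G0 x : setT x -> (0 <= (g x)%:E)%E by rewrite lee_fin.
rewrite ge0_integral_mscale //.
rewrite ge0_integral_measure_sum //.
rewrite /skewed_sum EFinM -sumEFin; congr (_ * _)%E; apply: eq_bigr => k _.
rewrite !ge0_integral_measure_add //.
rewrite !integral_dirac //.
by rewrite !diracT !mul1e.
Qed.

Hypothesis n_gt0 : (0 < n)%N.

Let skewed_setT : skewed_law setT = 1%E.
Proof.
rewrite -[LHS]mul1e -(@integral_cst _ _ _ skewed_law setT measurableT 1).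
rewrite (@ge0_integral_skewed (cst 1)) //.
rewrite /skewed_sum /= big_const_ord iter_addr addr0 -mulr_natr.
by congr EFin; field; rewrite pnatr_eq0 -lt0n.
Qed.

Definition skewed_prob : probability 'cV[R]_n R :=
  HB.pack skewed_law (@Measure_isProbability.Build _ _ R skewed_law skewed_setT).

Let skewed_integrable (f : 'cV[R]_n -> R) : measurable_fun setT f ->
  skewed_prob.-integrable setT (EFin \o f).
Proof.
move=> mf; apply/integrableP; split; first exact/measurable_EFinP.
rewrite (@ge0_integral_skewed (fun x => `|f x|)) ?ltry //.
exact: measurableT_comp.
Qed.

Lemma skewed_Rintegral (f : 'cV[R]_n -> R) : measurable_fun setT f ->
  \int[skewed_prob]_x f x = skewed_sum f.
Proof.
move=> mf.
have mN : measurable_fun setT (fun x => `|f x|) by exact: measurableT_comp.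
have ge0 (g : 'cV[R]_n -> R) : measurable_fun setT g -> (forall x, 0 <= g x) ->
    \int[skewed_prob]_x g x = skewed_sum g.
  by move=> mg g0; rewrite /Rintegral ge0_integral_skewed.
(* Writing [f] as a difference of two nonnegative functions reduces the claim to
   [ge0_integral_skewed]. *)
transitivity (\int[skewed_prob]_x (`|f x| + f x - `|f x|)).
  by apply: eq_Rintegral => x _; rewrite addrAC subrr add0r.
rewrite RintegralB //; last 2 first.
- by apply: skewed_integrable; exact: measurable_funD.
- exact: skewed_integrable.
rewrite !ge0 //; last 2 first.
- exact: measurable_funD.
- by move=> x; have := ler_norm (- f x); rewrite normrN; lra.
rewrite /skewed_sum -mulrBr -sumrB; congr (_ * _); apply: eq_bigr => k _.
by ring.
Qed.

(** The atoms attached to the other axes have [i]-th coordinate 0, where [h] vanishes. *)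
Let skewed_coord (h : R -> R) i : h 0 = 0 -> measurable_fun setT h ->
  \int[skewed_prob]_x h (x i 0) = (3 * n%:R)^-1 * (h 2 + (h (- 1) + h (- 1))).
Proof.
move=> h0 mh; rewrite skewed_Rintegral; last first.
  by apply: measurableT_comp => //; exact: measurable_coord.
congr (_ * _); rewrite (bigD1 i) //= big1 ?addr0.
  by rewrite !mxE eqxx mulr1.
move=> k ki; rewrite !mxE.
have -> : (val i == k) = false by rewrite eq_sym; exact/negbTE.
by rewrite mulr0 oppr0 h0 !addr0.
Qed.

Lemma mean_skewed : mean skewed_prob = 0.
Proof.
apply/matrixP => i j; rewrite ord1 meanE (@skewed_coord id) // mxE.
by rewrite (_ : 2 + _ = 0) ?mulr0 //; ring.
Qed.

(** On the diagonal, [(4 + 1 + 1) / (3 * n)] is [2 / n]. Off the diagonal, every atom lies on an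
    axis, so the product of two distinct coordinates is 0. *)
Lemma cov_skewed : cov skewed_prob = (2 / n%:R)%:M.
Proof.
have nn0 : n%:R != 0 :> R by rewrite pnatr_eq0 -lt0n.
apply/matrixP => i j; have [<-|ij] := eqVneq i j.
  rewrite cov_cmoment /cmoment mean_skewed mxE.
  under eq_Rintegral do rewrite subr0.
  rewrite (@skewed_coord (fun x => x ^+ 2)) ?expr0n //.
  by rewrite mxE eqxx mulr1n; field.
rewrite mxE covariance.unlock expectation.unlock.
transitivity (\int[skewed_prob]_x (x i 0 * x j 0)).
  congr fine; apply: eq_integral => x _ /=; congr EFin.
  have m0 k : fine (\int[skewed_prob]_w (w k 0)%:E) = 0.
    by rewrite -[LHS]/(\int[skewed_prob]_w w k 0) -meanE mean_skewed mxE.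
  by rewrite !m0 -[LHS]/((x i 0 - 0) * (x j 0 - 0)) !subr0.
rewrite skewed_Rintegral; last by apply: measurable_funM; exact: measurable_coord.
rewrite /skewed_sum big1 ?mulr0 ?mxE ?(negbTE ij) // => k _; rewrite !mxE.
have [ik|ik] := eqVneq (val i) k; last by rewrite mulr0 oppr0 !mul0r !addr0.
have [jk|jk] := eqVneq (val j) k; last by rewrite mulr0 oppr0 !mulr0 !addr0.
by case/eqP: ij; apply: val_inj; rewrite ik jk.
Qed.

(** The value is [(8 - 1 - 1) / (3 * n)]; being nonzero, it can be cancelled when third moments are
    compared. *)
Lemma skewed_cmoment3 i : cmoment skewed_prob i 3 = 2 / n%:R.
Proof.
have nn0 : n%:R != 0 :> R by rewrite pnatr_eq0 -lt0n.
rewrite /cmoment mean_skewed mxE.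
under eq_Rintegral do rewrite subr0.
rewrite (@skewed_coord (fun x => x ^+ 3)) ?expr0n //.
by field.
Qed.

Lemma posdef_scalar (c : R) : 0 < c -> posdef (c%:M : 'M[R]_n).
Proof.
move=> c0; split; first exact: tr_scalar_mx.
move=> u u0; rewrite mul_mx_scalar -scalemxAl mxE mulr_gt0 // mxE.
under eq_bigr do rewrite mxE -expr2.
rewrite lt_neqAle sumr_ge0 ?andbT => [|i _]; last exact: sqr_ge0.
apply: contra u0; rewrite eq_sym psumr_eq0 => [/allP h|i _]; last exact: sqr_ge0.
apply/eqP/matrixP => i j; rewrite ord1 mxE.
by have /= := h i (mem_index_enum i); rewrite sqrf_eq0 => /eqP.
Qed.

Lemma P3plus_skewed : P3plus skewed_prob.
Proof.
split; last by rewrite cov_skewed; apply: posdef_scalar; rewrite divr_gt0 // ltr0n.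
rewrite (@ge0_integral_skewed (fun x => enorm x ^+ 3)) ?ltry //.
  by apply: measurable_funX; exact: measurable_enorm.
by move=> x; rewrite exprn_ge0 // sqrtr_ge0.
Qed.

End skewed_law.

(** * Solutions of the multiplicative Cauchy equation on the half-line *)

Section multiplicative_semigroup.
Context {R : realType}.
Variable a : R -> R.
Hypothesis a_cont : {within [set t : R | 0 <= t], continuous a}.
Hypothesis a0 : a 0 = 1.
Hypothesis a_01 : forall t, 0 <= t -> 0 <= a t <= 1.
Hypothesis aD : forall s t, 0 <= s -> 0 <= t -> a (s + t) = a s * a t.

Lemma multiplicative_natmul (t : R) n : 0 <= t -> a (n%:R * t) = a t ^+ n.
Proof.
move=> t0; elim: n => [|n IH]; first by rewrite mul0r a0 expr0.
by rewrite -natr1 mulrDl mul1r aD ?mulr_ge0 // IH exprSr.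
Qed.

(* A zero at t would propagate to t / n for all n, against a 0 = 1. *)
Lemma multiplicative_gt0 (t : R) : 0 <= t -> 0 < a t.
Proof.
move=> t0; rewrite lt_neqAle; have /andP[-> _] := a_01 t0.
rewrite andbT eq_sym; apply/negP => /eqP at0.
have az n : a (t / n.+1%:R) = 0.
  have h : 0 <= t / n.+1%:R by rewrite divr_ge0.
  have := multiplicative_natmul n.+1 h.
  rewrite mulrC divfK ?pnatr_eq0// at0 => /esym/eqP.
  by rewrite expf_eq0 => /andP[_ /eqP].
have cv : (fun n => t / n.+1%:R) @ \oo --> (0 : R).
  rewrite -[X in _ --> X](mulr0 t); apply: cvgMr.
  exact: cvg_harmonic.
have /subspace_continuousP ca := a_cont.

have {}ca := ca 0 (lexx 0).
have : (fun n => a (t / n.+1%:R)) @ \oo --> a 0.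
  move=> A /ca; rewrite /nbhs /= /within /= => /cv.
  rewrite /nbhs /=; apply: filterS => n; apply.
  by rewrite /= divr_ge0.
under eq_fun do rewrite az.
move=> /cvg_lim; rewrite lim_cst // a0 => /(_ (@Rhausdorff R)) /esym/eqP.
by rewrite oner_eq0.
Qed.

(** The quotient of the two values is [a (t - s)], which is at most 1. *)
Lemma multiplicative_noninc (s t : R) : 0 <= s -> s <= t -> a t <= a s.
Proof.
move=> s0 st; have ts : 0 <= t - s by rewrite subr_ge0.
rewrite -(subrK s t) addrC aD // ler_piMr //.
  by have /andP[] := a_01 s0.
by have /andP[] := a_01 ts.
Qed.

(** Continuity enters through the positivity of [a], which allows taking logarithms. Then
    [f = - ln a] is monotone and compatible with integer multiples, hence linear with slope
    [c = f 1]. *)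
Lemma multiplicative_expR : (exists t, 0 < t /\ a t < 1) ->
  exists2 c : R, 0 < c & forall t, 0 <= t -> a t = expR (- (c * t)).
Proof.
move=> [u [u0 au1]].
pose f t := - ln (a t).
have af t : 0 <= t -> a t = expR (- f t).
  by move=> t0; rewrite /f opprK lnK // posrE multiplicative_gt0.
have fle (s t : R) : 0 <= s -> s <= t -> f s <= f t.
  move=> s0 st; rewrite /f lerN2 ler_ln ?posrE ?multiplicative_gt0 //.
    exact: multiplicative_noninc.
  exact: le_trans s0 st.
have fn (t : R) n : 0 <= t -> f (n%:R * t) = n%:R * f t.
  move=> t0; rewrite /f multiplicative_natmul // lnXn ?multiplicative_gt0 //.
  by rewrite mulr_natl mulNrn.
have f1 : 0 <= f 1.
  by rewrite /f oppr_ge0 ln_le0 //; have /andP[] := a_01 ler01.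
have flin (t : R) : 0 <= t -> f t = f 1 * t.
  move=> t0; apply/eqP; rewrite -subr_eq0 -normr_le0.
  rewrite leNgt; apply/negP => h.
  set e := `|_| in h.
  (* Scaling time by [n.+1] amplifies a gap [e > 0] beyond [f 1], while [k1] to [k4] will bound the
     scaled gap by [f 1]. *)
  have [n hn] : exists n : nat, f 1 < n.+1%:R * e.
    exists (Num.truncn (f 1 / e)).
    rewrite -ltr_pdivrMr //.
    by rewrite truncnS_gt.
  have nt0 : 0 <= n.+1%:R * t by rewrite mulr_ge0.
  have /andP[h1 h2] := truncn_itv nt0.
  (* With [k] the integer part of [n.+1 * t], both [n.+1 * f t] and [n.+1 * t * f 1] lie between
     [k * f 1] and [k.+1 * f 1]. *)
  set k := Num.truncn _ in h1 h2.
  have k1 : k%:R * f 1 <= n.+1%:R * f t.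
    by rewrite -!fn // mulr1; exact: fle.
  have k2 : n.+1%:R * f t <= k.+1%:R * f 1.
    by rewrite -!fn // mulr1; exact: (fle _ _ nt0 (ltW h2)).
  have k3 : k%:R * f 1 <= n.+1%:R * t * f 1 by exact: ler_wpM2r.
  have k4 : n.+1%:R * t * f 1 <= k.+1%:R * f 1 by apply: ler_wpM2r => //; exact: ltW.
  have : n.+1%:R * e <= f 1.
    rewrite /e -[X in X * _]ger0_norm // -normrM ler_norml.
    rewrite -natr1 in k2 k4.
    by apply/andP; split; lra.
  by rewrite leNgt hn.
exists (f 1); last by move=> t t0; rewrite af // flin.
(* A zero slope would make [a] constantly 1, against [a u < 1]. *)
rewrite lt_neqAle f1 andbT eq_sym; apply/negP => /eqP f10.
by move: au1; rewrite af ?ltW // flin ?ltW // f10 mul0r oppr0 expR0 ltxx.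
Qed.

End multiplicative_semigroup.

(** * Identification of the coefficients and the time change *)

Theorem theorem7p1 (R : realType) (d : nat) (d_gt0 : (0 < d)%N)
    (T : R -> probability 'cV[R]_d R -> probability 'cV[R]_d R)
    (a b : R -> R)
    (T_P3plus : forall (t : R) (P : probability 'cV[R]_d R),
      0 <= t -> P3plus P -> P3plus (T t P))
    (T_form : forall (t : R) (P : probability 'cV[R]_d R),
      0 <= t -> P3plus P -> gaussianization (a t) (b t) P (T t P))
    (a_cont : {within [set t : R | 0 <= t], continuous a})
    (b_cont : {within [set t : R | 0 <= t], continuous b})
    (a0 : a 0 = 1) (b0 : b 0 = 0)
    (b_ge0 : forall t : R, 0 <= t -> 0 <= b t)
    (a_01 : forall t : R, 0 <= t -> 0 <= a t <= 1)
    (T_mean_cov : forall (t : R) (P : probability 'cV[R]_d R),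
      0 <= t -> P3plus P -> mean (T t P) = mean P /\ cov (T t P) = cov P)
    (T_semigroup : forall (s t : R) (P : probability 'cV[R]_d R),
      0 <= s -> 0 <= t -> P3plus P ->
      same_law (T (s + t) P) (T s (T t P)))
    (T_nontrivial : exists t : R, 0 < t /\ a t < 1) :
  exists c : R, [/\ 0 < c,
    forall t : R, 0 <= t ->
      a t = expR (- (c * t)) /\ b t = Num.sqrt (1 - expR (- (2 * c * t))) &
    forall (t : R) (P : probability 'cV[R]_d R),
      0 <= t -> P3plus P -> gaussianization (expR (- t)) (Num.sqrt (1 - expR (- (2 * t)))) P
        (T (t / c) P)].
Proof.
pose i := Ordinal d_gt0; pose P0 := @skewed_prob R d d_gt0.
have hP0 : P3plus P0 by exact: P3plus_skewed.
have cm (t : R) (P : probability 'cV[R]_d R) : 0 <= t -> P3plus P ->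
    cmoment (T t P) i 2 = (a t ^+ 2 + b t ^+ 2) * cmoment P i 2 /\
    cmoment (T t P) i 3 = a t ^+ 3 * cmoment P i 3.
  move=> t0 hP; apply: gaussianization_cmoment => //.
  - exact: T_P3plus.
  - by have [] := T_mean_cov t P t0 hP.
  - exact: T_form.
(* Preservation of the covariance on the test law, after cancelling the nonzero variance [2 / d]. *)
have ab (t : R) : 0 <= t -> a t ^+ 2 + b t ^+ 2 = 1.
  move=> t0; have [+ _] := cm t P0 t0 hP0.
  rewrite -!cov_cmoment (T_mean_cov t P0 t0 hP0).2 cov_skewed mxE eqxx mulr1n.
  rewrite -[X in X = _]mul1r => /mulIf; rewrite mulf_neq0 ?invr_eq0 ?pnatr_eq0 -?lt0n //.
  by move=> /(_ isT) ->.
have aD (s t : R) : 0 <= s -> 0 <= t -> a (s + t) = a s * a t.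
  move=> s0 t0.
  have hTt := T_P3plus t P0 t0 hP0; have st0 := addr_ge0 s0 t0.
  (* All the means equal that of [P0], so the two integrands coincide and the equality of laws
     suffices. *)
  have e3 : cmoment (T (s + t) P0) i 3 = cmoment (T s (T t P0)) i 3.
    rewrite /cmoment (T_mean_cov _ _ st0 hP0).1 (T_mean_cov _ _ s0 hTt).1.
    rewrite (T_mean_cov _ _ t0 hP0).1; congr fine.
    by apply: eq_measure_integral => A mA _; exact: T_semigroup.
  move: e3; rewrite (cm _ _ st0 hP0).2 (cm _ _ s0 hTt).2 (cm _ _ t0 hP0).2.
  rewrite mulrA skewed_cmoment3 -exprMn => /mulIf.
  rewrite mulf_neq0 ?invr_eq0 ?pnatr_eq0 -?lt0n // => /(_ isT) /eqP.
  (* Nonnegativity lets the cubes be removed from [a (s + t) ^+ 3 = (a s * a t) ^+ 3]. *)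
  have a_ge0 u : 0 <= u -> 0 <= a u by move=> /a_01 /andP[].
  by rewrite eqrXn2 ?mulr_ge0 ?a_ge0 // => /eqP.
have [c c0 aE] := multiplicative_expR a_cont a0 a_01 aD T_nontrivial.
have bE t : 0 <= t -> b t = Num.sqrt (1 - expR (- (2 * c * t))).
  move=> t0; have -> : expR (- (2 * c * t)) = a t ^+ 2.
    by rewrite aE // -expRM_natl; congr expR; ring.
  (* The sign condition on [b] selects the nonnegative root of [b t ^+ 2 = 1 - a t ^+ 2]. *)
  by rewrite -(ab t t0) addrAC subrr add0r sqrtr_sqr ger0_norm // b_ge0.
exists c; split=> // t; first by move=> t0; rewrite aE // bE.
(* Evaluating the family at [t / c] turns the rate [c] into 1. *)
move=> P t0 hP; have tc0 : 0 <= t / c by rewrite divr_ge0 // ltW.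
have := T_form _ _ tc0 hP; rewrite aE // bE //.
have c_neq0 : c != 0 by rewrite gt_eqF.
have -> : c * (t / c) = t by field.
by have -> : 2 * c * (t / c) = 2 * t by field.
Qed.
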